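(* Let $X$ be a cell complex, let $\mathcal{C}_2(X)$ be the unordered configuration space of pairs of distinct points of $X$, and let $\tilde{\mathcal{P}}\to\mathcal{C}_2(X)$ be the dual-aperture $\mathbb{Z}_2$-torsor. Then any exchange loop in $\mathcal{C}_2(X)$ has nontrivial monodromy in $\tilde{\mathcal{P}}$; that is, transport along an exchange loop acts on the fiber over its basepoint as the nontrivial element of $\mathbb{Z}_2$ (it interchanges the two elements of the fiber).
   Context: $\mathcal{C}_2(X)=\{\{p,q\}\subset X : p\neq q\}$ is topologized as the quotient of the ordered configuration space $(X\times X)\setminus\Delta$ (where $\Delta$ is the diagonal) by the swap $(p,q)\mapsto(q,p)$. Dual-aperture torsor: two apertures located at $p$ and $q$ each display a state in $\mathbb{Z}_2=\{0,1\}$, subject to the opposite-spin rule that the two displayed states differ. Thus the fiber of $\tilde{\mathcal{P}}$ over $\{p,q\}$ is the two-element set of bijections $s:\{p,q\}\to\mathbb{Z}_2$ (a choice of which point shows $0$ and which shows $1$), with $\mathbb{Z}_2$ acting by adding a constant to $s$ (so the nontrivial element exchanges the two bijections). $\tilde{\mathcal{P}}$ is topologized as a double cover of $\mathcal{C}_2(X)$ in which transport along a path preserves the state displayed by each moving aperture: as the two points move continuously, each carries its state with it. Exchange loop: a closed loop in $\mathcal{C}_2(X)$ based at some $\{p,q\}$ along which the two points continuously interchange positions while remaining distinct, i.e. the image in $\mathcal{C}_2(X)$ of a continuous path in $(X\times X)\setminus\Delta$ from $(p,q)$ to $(q,p)$. *)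

(* Defs.v *)
From HB Require Import structures.
From mathcomp Require Import all_boot all_order all_algebra.
From mathcomp Require Import all_classical all_reals all_analysis.
From mathcomp Require Import continuous_path.

Set Implicit Arguments.
Unset Strict Implicit.
Unset Printing Implicit Defensive.

Import Order.TTheory GRing.Theory Num.Theory.
Import numFieldNormedType.Exports.

Local Open Scope classical_set_scope.
Local Open Scope ring_scope.

Definition sqnorm2 (R : realType) (n : nat) (x : 'rV[R]_n) : R :=
  \sum_(k < n) x 0 k ^+ 2.
Definition disk (R : realType) (n : nat) : set 'rV[R]_n :=
  [set x | sqnorm2 x <= 1].
Definition open_disk (R : realType) (n : nat) : set 'rV[R]_n :=
  [set x | sqnorm2 x < 1].
Definition unit_sphere (R : realType) (n : nat) : set 'rV[R]_n :=
  [set x | sqnorm2 x = 1].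
Arguments disk {R} n.
Arguments open_disk {R} n.
Arguments unit_sphere {R} n.

(* CW structure on X, in the intrinsic form of Hatcher, Algebraic Topology,
   Prop. A.2.  Only the values of a characteristic map on the closed disk
   matter. *)
Record cell_complex (R : realType) (X : topologicalType) := CellComplex {
  cell : Type;
  cdim : cell -> nat;
  char_map : forall i : cell, 'rV[R]_(cdim i) -> X;
  open_cell := fun i : cell => @char_map i @` open_disk (cdim i);
  cc_hausdorff : hausdorff_space X;
  cc_continuous : forall i, {within disk (cdim i), continuous (@char_map i)};
  (* char_map i is a homeomorphism from the open disk onto open_cell i *)
  cc_injective : forall i, set_inj (open_disk (cdim i)) (@char_map i);
  cc_open : forall i (U : set 'rV[R]_(cdim i)), open U ->
    exists V : set X, open V /\
      @char_map i @` (U `&` open_disk (cdim i)) = V `&` open_cell i;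
  cc_disjoint : trivIset setT open_cell;
  cc_cover : \bigcup_i open_cell i = setT;
  cc_closure_finite : forall i, exists J : set cell,
    [/\ finite_set J, forall j, J j -> (cdim j < cdim i)%N &
        @char_map i @` unit_sphere (cdim i) `<=` \bigcup_(j in J) open_cell j];
  cc_weak : forall A : set X,
    closed A <-> (forall i, closed (A `&` closure (open_cell i)))
}.

Definition oconf (X : topologicalType) : Type :=
  [set pq : X * X | pq.1 <> pq.2].

HB.instance Definition _ (X : topologicalType) :=
  Topological.copy (oconf X) (set_type [set pq : X * X | pq.1 <> pq.2]).

Definition pt1 (X : topologicalType) (w : oconf X) : X := (val w).1.
Definition pt2 (X : topologicalType) (w : oconf X) : X := (val w).2.

Lemma oconfP (X : topologicalType) (w : oconf X) : pt1 w <> pt2 w.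
Proof. exact: (set_valP w). Qed.

Definition mk_oconf (X : topologicalType) (p q : X) (pq : p <> q) : oconf X :=
  SigSub (mem_set (pq : [set pq : X * X | pq.1 <> pq.2] (p, q))).

Definition swap (X : topologicalType) (w : oconf X) : oconf X :=
  mk_oconf (nesym (@oconfP X w)).

Record upair (X : topologicalType) := UPair {
  upair_set : set X;
  upairP : exists p q : X, p <> q /\ upair_set = [set p; q]
}.

Definition upair_of (X : topologicalType) (w : oconf X) : upair X :=
  UPair (ex_intro _ (pt1 w) (ex_intro _ (pt2 w) (conj (@oconfP X w) erefl))).

Lemma upair_inj (X : topologicalType) (c d : upair X) :
  upair_set c = upair_set d -> c = d.
Proof.
case: c d => [A hA] [B hB] /= AB; case: B / AB hB => hB.
by congr UPair; exact: Prop_irrelevance.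
Qed.

Lemma upair_of_surj (X : topologicalType) (c : upair X) :
  exists w, upair_of w = c.
Proof.
have [p [q [pq cE]]] := upairP c.
by exists (mk_oconf pq); apply: upair_inj; rewrite cE.
Qed.

Definition upair_repr (X : topologicalType) (c : upair X) : oconf X :=
  projT1 (cid (upair_of_surj c)).

Lemma upair_reprK (X : topologicalType) :
  cancel (@upair_repr X) (@upair_of X).
Proof. by move=> c; rewrite /upair_repr; case: cid. Qed.

HB.instance Definition _ (X : topologicalType) :=
  isQuotient.Build (oconf X) (upair X) (@upair_reprK X).

Definition uconf (X : topologicalType) : topologicalType :=
  quotient_topology (upair X).

Definition unordered (X : topologicalType) : oconf X -> uconf X := @upair_of X.

Definition points (X : topologicalType) (c : uconf X) : set X := upair_set c.

Record dual_aperture (X : topologicalType) := DualAperture {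
  base : uconf X;
  state : points base -> 'Z_2;
  state_bij : bijective state
}.

HB.instance Definition _ (X : topologicalType) := gen_eqMixin (dual_aperture X).
HB.instance Definition _ (X : topologicalType) :=
  gen_choiceMixin (dual_aperture X).

Definition shift_state (X : topologicalType) (a : 'Z_2) (e : dual_aperture X)
    (x : points (base e)) : 'Z_2 :=
  state x + a.

Lemma shift_state_bij (X : topologicalType) (a : 'Z_2) (e : dual_aperture X) :
  bijective (@shift_state X a e).
Proof.
have [g gK Kg] := state_bij e; exists (fun b => g (b - a)) => x.
  by rewrite /shift_state addrK gK.
by rewrite /shift_state Kg subrK.
Qed.

Definition act (X : topologicalType) (a : 'Z_2) (e : dual_aperture X) :
  dual_aperture X := DualAperture (shift_state_bij a e).

(* the configuration {pt1 w, pt2 w} in which pt1 w displays a *)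
Definition show_state (X : topologicalType) (a : 'Z_2) (w : oconf X)
    (x : points (unordered w)) : 'Z_2 :=
  if val x == pt1 w then a else a + 1.

Lemma show_state_bij (X : topologicalType) (a : 'Z_2) (w : oconf X) :
  bijective (@show_state X a w).
Proof.
have h1 : points (unordered w) (pt1 w) by left.
have h2 : points (unordered w) (pt2 w) by right.
exists (fun b => if b == a then SigSub (mem_set h1) else SigSub (mem_set h2)).
  move=> x; apply: val_inj; rewrite /show_state.
  have [xE|xN] := eqVneq (val x) (pt1 w); first by rewrite eqxx; exact: esym.
  rewrite -{2}(addr0 a) (inj_eq (addrI a)) oner_eq0 /=.
  by case: (set_valP x) => // xE; case/eqP: xN.
move=> b; rewrite /show_state; case: (eqVneq b a) => [->|ba].
  by rewrite [val _]/= eqxx.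
rewrite [val _]/= ifF; last by apply/eqP; exact/nesym/oconfP.
by case: b a ba => [[|[|//]] ?] [[|[|//]] ?] // _; apply: val_inj.
Qed.

Definition show (X : topologicalType) (a : 'Z_2) (w : oconf X) :
  dual_aperture X := DualAperture (show_state_bij a w).

(* The finest topology for which, as an ordered pair moves in oconf X with a
   constant state carried by each of the two points, the configuration moves
   continuously. *)
Definition dual_aperture_open (X : topologicalType)
    (U : set (dual_aperture X)) : Prop :=
  forall a : 'Z_2, open (show (X := X) a @^-1` U).

Lemma dual_aperture_openT (X : topologicalType) :
  @dual_aperture_open X setT.
Proof. by move=> a; rewrite preimage_setT; exact: openT. Qed.

Lemma dual_aperture_openI (X : topologicalType) :
  setI_closed (@dual_aperture_open X).
Proof. by move=> A B oA oB a; exact: openI (oA a) (oB a). Qed.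

Lemma dual_aperture_open_bigU (X : topologicalType) (I : Type)
    (f : I -> set (dual_aperture X)) :
  (forall i, dual_aperture_open (f i)) ->
  dual_aperture_open (\bigcup_i f i).
Proof. by move=> of_ a; apply: bigcup_open => i _; exact: of_. Qed.

HB.instance Definition _ (X : topologicalType) :=
  isOpenTopological.Build (dual_aperture X) (@dual_aperture_openT X)
    (@dual_aperture_openI X) (@dual_aperture_open_bigU X).

Lemma act_base (X : topologicalType) (a : 'Z_2) (e : dual_aperture X) :
  base (act a e) = base e.
Proof. reflexivity. Qed.

Lemma dual_aperture_eq (X : topologicalType) (e e' : dual_aperture X) :
  points (base e) = points (base e') ->
  (forall (x : points (base e)) (y : points (base e')),
     val x = val y -> state x = state y) -> e = e'.
Proof.
case: e e' => [c s sb] [c' s' sb'] /= /upair_inj cc'; case: c' / cc' s' sb'.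
move=> s' sb' ss'; have {}ss' : s = s' by apply/funext => x; exact: ss'.
by case: s' / ss' sb' => sb'; congr DualAperture; exact: Prop_irrelevance.
Qed.

Lemma actD (X : topologicalType) (a b : 'Z_2) (e : dual_aperture X) :
  act a (act b e) = act (b + a) e.
Proof.
apply: dual_aperture_eq => // x y /val_inj -> /=.
by rewrite /shift_state /= /shift_state addrA.
Qed.

Lemma act0 (X : topologicalType) (e : dual_aperture X) : act 0 e = e.
Proof.
apply: dual_aperture_eq => // x y /val_inj -> /=.
by rewrite /shift_state addr0.
Qed.

Lemma act_show (X : topologicalType) (a b : 'Z_2) (w : oconf X) :
  act a (show b w) = show (b + a) w.
Proof.
apply: dual_aperture_eq => // x y /val_inj -> /=.
by rewrite /shift_state /= /show_state; case: ifP => // _; rewrite addrAC.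
Qed.

Lemma Z2_addr1r1 (a : 'Z_2) : a + 1 + 1 = a.
Proof. by case: a => [[|[|//]] ?]; apply: val_inj. Qed.

Lemma show_swap (X : topologicalType) (a : 'Z_2) (w : oconf X) :
  show a (swap w) = show (a + 1) w.
Proof.
apply: dual_aperture_eq => [|x y xy /=].
  by rewrite /points /= setUC.
rewrite /show_state xy Z2_addr1r1.
have -> : pt1 (swap w) = pt2 w by [].
have w12 := @oconfP X w.
by case: (set_valP y) => ->; rewrite eqxx ifF //; apply/eqP => // /esym.
Qed.

Lemma show0_surj (X : topologicalType) (e : dual_aperture X) :
  exists w, show 0 w = e.
Proof.
have [g gK Kg] := state_bij e.
have g01 : val (g 0) <> val (g 1).
  by move=> /val_inj /(congr1 (@state X e)); rewrite !Kg.
have xg (x : points (base e)) : val x = val (g (state x)).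
  by rewrite gK.
have Z2E (a : 'Z_2) : a = 0 \/ a = 1.
  by case: a => [[|[|//]] ?]; [left|right]; apply: val_inj.
exists (mk_oconf g01); apply: dual_aperture_eq => [|x y xy].
  apply/seteqP; split => [z [->|->]|z zb]; try exact: set_valP.
  pose x : points (base e) := SigSub (mem_set zb).
  have -> : z = val (g (state x)) by rewrite -xg.
  by case: (Z2E (state x)) => ->; [left|right].
rewrite /= /show_state xy /pt1 /= [in LHS]xg.
case: (Z2E (state y)) => ->; first by rewrite eqxx.
by rewrite ifF ?add0r//; apply/eqP; exact: nesym.
Qed.

Lemma act_free (X : topologicalType) (a : 'Z_2) (e : dual_aperture X) :
  act a e = e -> a = 0.
Proof.
move=> aee; have [g gK Kg] := state_bij e.
pose D (d : dual_aperture X) (x : X) (b : 'Z_2) :=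
  exists y : points (base d), val y = x /\ state y = b.
have : D (act a e) (val (g 0)) (0 + a).
  by exists (g 0); split => //=; rewrite /shift_state Kg.
rewrite aee => -[y [/val_inj -> ]].
by rewrite Kg add0r => <-.
Qed.

Lemma oconf_eq (X : topologicalType) (w w' : oconf X) :
  pt1 w = pt1 w' -> pt2 w = pt2 w' -> w = w'.
Proof.
case: w w' => [[p q] pq] [[p' q'] pq']; rewrite /pt1 /pt2 /= => pp' qq'.
by apply: val_inj; rewrite /= pp' qq'.
Qed.

Lemma unordered_eq (X : topologicalType) (w w' : oconf X) :
  unordered w = unordered w' -> w = w' \/ w = swap w'.
Proof.
move=> ww'; have w12 := @oconfP X w.
have ptsE : points (unordered w) = points (unordered w') by rewrite ww'.
have : points (unordered w') (pt1 w) by rewrite -ptsE; left.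
have : points (unordered w') (pt2 w) by rewrite -ptsE; right.
case=> p2E [] p1E.
- by case: w12; rewrite p1E p2E.
- by right; exact: oconf_eq.
- by left; exact: oconf_eq.
- by case: w12; rewrite p1E p2E.
Qed.

Lemma show_inj (X : topologicalType) (a : 'Z_2) : injective (@show X a).
Proof.
move=> w w' ww'; have [//|wE] : w = w' \/ w = swap w'.
  exact/unordered_eq/(congr1 (@base X) ww').
move: ww'; rewrite wE show_swap -act_show => /act_free/eqP.
by rewrite oner_eq0.
Qed.

Lemma act_simply_transitive (X : topologicalType) (e e' : dual_aperture X) :
  base e = base e' -> exists! a, e' = act a e.
Proof.
move=> ee'; suff [a ae] : exists a, e' = act a e.
  exists a; split => // b be; apply/eqP; rewrite eq_sym -subr_eq0; apply/eqP.
  by apply: (@act_free X _ (act a e)); rewrite actD addrC subrK -be.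
move: ee'; have [w <-] := show0_surj e; have [w' <-] := show0_surj e'.
move=> /unordered_eq[->|->]; first by exists 0; rewrite act0.
by exists 1; rewrite show_swap act_show Z2_addr1r1.
Qed.

Lemma unorderedE (X : topologicalType) :
  \pi_(quotient_topology (upair X))%qT = @unordered X.
Proof. by rewrite unlock. Qed.

Lemma uconf_openE (X : topologicalType) (U : set (uconf X)) :
  open U = open (@unordered X @^-1` U).
Proof.
by rewrite -unorderedE; reflexivity.
Qed.

Lemma dual_aperture_openE (X : topologicalType) (U : set (dual_aperture X)) :
  open U = forall a, open (show (X := X) a @^-1` U).
Proof. reflexivity. Qed.

Lemma Z2E (a : 'Z_2) : a = 0 \/ a = 1.
Proof. by case: a => [[|[|//]] ?]; [left|right]; apply: val_inj. Qed.

Lemma pt1_continuous (X : topologicalType) : continuous (@pt1 X).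
Proof.
move=> w; apply: (@continuous_comp (oconf X) _ _ val fst).
  exact: initial_continuous.
exact: cvg_fst.
Qed.

Lemma pt2_continuous (X : topologicalType) : continuous (@pt2 X).
Proof.
move=> w; apply: (@continuous_comp (oconf X) _ _ val snd).
  exact: initial_continuous.
exact: cvg_snd.
Qed.

Lemma show_continuous (X : topologicalType) (a : 'Z_2) :
  continuous (@show X a).
Proof. by apply/continuousP => A; exact. Qed.

Lemma act_continuous (X : topologicalType) (a : 'Z_2) :
  continuous (@act X a).
Proof.
apply/continuousP => A oA; rewrite dual_aperture_openE => b.
rewrite (_ : _ @^-1` _ = show (b + a) @^-1` A); first exact: oA.
by apply/seteqP; split => w /=; rewrite act_show.
Qed.

Lemma base_continuous (X : topologicalType) : continuous (@base X).
Proof.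
apply/continuousP => A oA; rewrite dual_aperture_openE => a.
by move: oA; rewrite uconf_openE.
Qed.

Lemma base_open (X : topologicalType) (U : set (dual_aperture X)) :
  open U -> open (@base X @` U).
Proof.
move=> oU; rewrite uconf_openE.
rewrite (_ : _ @^-1` _ = show 0 @^-1` U `|` show 1 @^-1` U).
  by apply: openU; exact: oU.
apply/seteqP; split => [w [e Ue]|w [Uw|Uw]].
- have [w' eE] := show0_surj e; move: Ue; rewrite -eE => Uw'.
  move=> /unordered_eq[<-|w'E]; first by left.
  by right => /=; rewrite -(add0r 1) -show_swap -w'E.
- by exists (show 0 w).
- by exists (show 1 w).
Qed.

(* The preimage of U is the disjoint union of the two sheets V and act 1 @` V,
   each of which base maps homeomorphically onto U. *)
Lemma evenly_covered (X : topologicalType) (c : uconf X) :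
  hausdorff_space X ->
  exists (U : set (uconf X)) (V : set (dual_aperture X)),
    [/\ open U, U c, open V, set_bij V U (@base X) &
        @base X @^-1` U = V `|` act 1 @` V /\ V `&` act 1 @` V = set0].
Proof.
move=> hX; have [w wc] := upair_of_surj c.
move: (hX); rewrite open_hausdorff => /(_ (pt1 w) (pt2 w)).
case=> [|[A B] /= [/set_mem Aw /set_mem Bw] [oA oB /eqP AB]].
  by apply/eqP; exact: oconfP.
have nAB x : A x -> B x -> False.
  by move=> Ax Bx; have : set0 x by rewrite -AB.
pose S A' B' : set (oconf X) := [set v | A' (pt1 v) /\ B' (pt2 v)].
have oS A' B' : open A' -> open B' -> open (S A' B').
  move=> oA' oB'; apply: (@openI _ (@pt1 X @^-1` A') (@pt2 X @^-1` B')).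
    exact: open_comp (in1W (@pt1_continuous X)) oA'.
  exact: open_comp (in1W (@pt2_continuous X)) oB'.
have oV : open (show 0 @` S A B).
  rewrite dual_aperture_openE => b; case: (Z2E b) => ->.
    rewrite (_ : _ @^-1` _ = S A B); first exact: oS.
    apply/seteqP; split => v /=; last by exists v.
    by move=> [v' Sv' /show_inj <-].
  rewrite (_ : _ @^-1` _ = S B A); first exact: oS.
  apply/seteqP; split => v /=.
    move=> [v' [Av' Bv']]; rewrite -[X in show X v]add0r -show_swap => /show_inj vE.
    by move: Av' Bv'; rewrite vE.
  by move=> [Bv Av]; exists (swap v) => //; rewrite show_swap add0r.
have Uw : (@base X @` (show 0 @` S A B)) c.
  by exists (show 0 w) => //; exists w.
have disj v v' : S A B v -> S A B v' -> v <> swap v'.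
  by move=> [Av _] [_ Bv'] vE; apply: (nAB (pt1 v)) => //; rewrite vE.
exists (@base X @` (show 0 @` S A B)), (show 0 @` S A B).
split=> //; first exact: base_open.
  split=> [e Ve|e e' /set_mem[v Sv <-] /set_mem[v' Sv' <-]|//].
    by exists e.
  by move=> /unordered_eq[->//|/disj]; case/(_ Sv Sv').
split.
  apply/seteqP; split => [e [_ [v Sv <-] ve]|e [Ve|[_ [v Sv <-] <-]]].
  - have [w' w'e] := show0_surj e; move: ve; rewrite -w'e.
    move=> /unordered_eq[<-|vE]; first by left; exists v.
    right; exists (show 0 v); first by exists v.
    by rewrite act_show vE show_swap Z2_addr1r1.
  - by exists e.
  - by exists (show 0 v) => //; exists v.
apply/seteqP; split => // e [[v Sv <-] [_ [v' Sv' <-]]].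
rewrite act_show -show_swap => /show_inj/esym.
exact: disj.
Qed.

Definition unit_itv (R : realType) : Type := [set` (`[0, 1] : interval R)].

HB.instance Definition _ (R : realType) :=
  Topological.copy (unit_itv R) (set_type [set` (`[0, 1] : interval R)]).

Lemma unit_itv0 (R : realType) : [set` (`[0, 1] : interval R)] 0.
Proof. by rewrite /= in_itv /= lexx ler01. Qed.

Lemma unit_itv1 (R : realType) : [set` (`[0, 1] : interval R)] 1.
Proof. by rewrite /= in_itv /= ler01 lexx. Qed.

Lemma unit_itv01 (R : realType) :
  (SigSub (mem_set (unit_itv0 R)) : unit_itv R) !=
   SigSub (mem_set (unit_itv1 R)).
Proof. by apply/eqP => /(congr1 val)/= /esym/eqP; rewrite oner_eq0. Qed.

HB.instance Definition _ (R : realType) :=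
  isBiPointed.Build (unit_itv R) (unit_itv01 R).

Definition exchange_loop (R : realType) (X : topologicalType) (c : uconf X)
    (gamma : {path unit_itv R from c to c}) : Prop :=
  exists (w : oconf X) (delta : {path unit_itv R from w to swap w}),
    forall t, gamma t = unordered (delta t).

Definition transports (R : realType) (X : topologicalType) (c d : uconf X)
    (gamma : {path unit_itv R from c to d}) (e e' : dual_aperture X) : Prop :=
  exists lift : {path unit_itv R from e to e'},
    forall t, base (lift t) = gamma t.

(* Transport along gamma is the graph of the map e |-> e + a on the fiber:
   every e has a lift of gamma starting at it, and all of them end at e + a. *)
Definition monodromy_is (R : realType) (X : topologicalType) (c : uconf X)
    (gamma : {path unit_itv R from c to c}) (a : 'Z_2) : Prop :=
  forall e e' : dual_aperture X, base e = c -> base e' = c ->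
    (transports gamma e e' <-> e' = act a e).

(* Main.v *)
(* If delta is an ordered path from (p, q) to (q, p), then show a \o delta lifts
   the loop and ends at show a (q, p) = act 1 (show a (p, q)).  Since X is
   Hausdorff, base is a covering map, so over the connected interval this is the
   only lift with its starting point, and it computes the monodromy. *)
Require Import Defs.
From HB Require Import structures.
From mathcomp Require Import all_boot all_order all_algebra.
From mathcomp Require Import all_classical all_reals all_analysis.
From mathcomp Require Import continuous_path.

Import Order.TTheory GRing.Theory Num.Theory.
Import numFieldNormedType.Exports.
Local Open Scope classical_set_scope.
Local Open Scope ring_scope.

(** A clopen [B] of the subtype is the trace of the open [W] and of the closed complement of [W'],
    so its image under [val] is relatively clopen in [A], hence all of [A]; injectivity of [val]
    carries this back to the subtype. *)
Lemma connected_set_type (T : topologicalType) (A : set T) :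
  connected A -> connected [set: set_type A].
Proof.
move=> cA B [x Bx] [C [W oW WC] BC] [D /closed_openC[W' oW' WD] BD].
have BW y : B y <-> W (val y) by rewrite BC setTI -WC.
have BW' y : B y <-> ~ W' (val y).
  by rewrite BD setTI; have := congr1 (@^~ y) WD => /= ->; rewrite /setC /= notK.
have vB : val @` B = A.
  apply: cA; first by exists (val x), x.
    exists W => //; apply/seteqP; split => [_ [y By <-]|y [Ay Wy]].
      by split; [exact: set_valP|exact/BW].
    by exists (SigSub (mem_set Ay)) => //; exact/BW.
  exists (~` W'); first exact: open_closedC.
  apply/seteqP; split => [_ [y By <-]|y [Ay Wy]].
    by split; [exact: set_valP|exact/BW'].
  by exists (SigSub (mem_set Ay)) => //; exact/BW'.
apply/seteqP; split => // y _.
have [z Bz /val_inj <- //] : (val @` B) (val y) by rewrite vB; exact: set_valP.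
Qed.

Lemma same_base (X : topologicalType) (e e' : dual_aperture X) :
  base e = base e' -> e' = e \/ e' = act 1 e.
Proof.
move=> /act_simply_transitive[a [-> _]].
by case: (Z2E a) => ->; [left; exact: act0|right].
Qed.

Lemma act1_neq (X : topologicalType) (e : dual_aperture X) : act 1 e <> e.
Proof. by move=> /act_free /eqP; rewrite oner_eq0. Qed.

(** Near a point of agreement both maps stay in one sheet over an evenly covered neighborhood, and
    [base] is injective on a sheet. *)
Lemma open_agree (T X : topologicalType) (f g : T -> dual_aperture X) :
  hausdorff_space X -> continuous f -> continuous g -> @base X \o f =1 @base X \o g ->
  open [set t | f t = g t].
Proof.
move=> hX cf cg fg; rewrite openE => t /= ftgt.
have [U [V [_ Uc oV [_ bV _] [UE _]]]] := evenly_covered (base (f t)) hX.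
have agree (k : 'Z_2) s : V (act k (f s)) -> V (act k (g s)) -> f s = g s.
  move=> Vf Vg; have : act k (f s) = act k (g s).
    by apply: bV; rewrite ?inE// !act_base; exact: fg.
  by move=> /(congr1 (act (- k))); rewrite !actD subrr !act0.
(* Translating by [k] brings the sheet through [f t] onto [V], so both sheets are handled at
   once. *)
suff [k Vk] : exists k, V (act k (f t)).
  have nbhsV h : continuous h -> V (act k (h t)) -> \forall s \near t, V (act k (h s)).
    move=> ch Vh; have ckh : {for t, continuous (act k \o h)}.
      apply: continuous_comp; first exact: ch.
      exact: act_continuous.
    by apply: ckh; exact: open_nbhs_nbhs.
  have := nbhsV f cf Vk; move: Vk; rewrite ftgt => /(nbhsV g cg).
  by apply: filterS2 => s Vg Vf; exact: agree Vf Vg.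
have : (@base X @^-1` U) (f t) by [].
rewrite UE => -[Vf|[e Ve eE]]; first by exists 0; rewrite act0.
by exists 1; rewrite -eE actD (_ : 1 + 1 = 0) ?act0//; apply: val_inj.
Qed.

(** The agreement set contains [t0] and is both open and closed, so connectedness makes it
    everything. *)
Lemma unique_lift (T X : topologicalType) (f g : T -> dual_aperture X) (t0 : T) :
  hausdorff_space X -> connected [set: T] -> continuous f -> continuous g ->
  @base X \o f =1 @base X \o g -> f t0 = g t0 -> f =1 g.
Proof.
move=> hX cT cf cg fg fg0 t.
suff : [set t | f t = g t] = setT by move=> /seteqP[_]; exact.
apply: cT; first by exists t0.
  by exists [set t | f t = g t]; [exact: open_agree|rewrite setTI].
exists [set t | f t = g t]; last by rewrite setTI.
rewrite -[X in closed X]setCK; apply: open_closedC.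
(* Fibers have two elements, so differing from [g] means agreeing with [act 1 \o g], another lift of
   the same map; [open_agree] then shows that the complement is open. *)
rewrite (_ : ~` _ = [set s | f s = act 1 (g s)]).
  apply: open_agree => // s; apply: continuous_comp; first exact: cg.
  exact: act_continuous.
apply/seteqP; split => s /=; last by move=> -> /act1_neq.
by case: (same_base _ _ _ (esym (fg s))).
Qed.

Lemma unit_itv_connected (R : realType) : connected [set: unit_itv R].
Proof. exact/connected_set_type/segment_connected. Qed.

Lemma transports_act1 (R : realType) (X : topologicalType) (c : uconf X)
    (gamma : {path unit_itv R from c to c}) (e e' : dual_aperture X) :
  hausdorff_space X -> exchange_loop gamma -> base e = c ->
  transports gamma e e' <-> e' = act 1 e.
Proof.
move=> hX [w [delta gammaE]] ec.
(* Here [a] is the state that [e] displays at [pt1 w]; it selects the lift of [delta] that starts at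
   the given [e]. *)
have [a ea] : exists a, e = show a w.
  have wc : base (show 0 w) = base e.
    by rewrite ec -(path_zero (s := gamma)) gammaE path_zero.
  by have [a [-> _]] := act_simply_transitive wc; exists (0 + a); exact: act_show.
pose f (t : unit_itv R) := show a (delta t).
have cf : continuous f.
  move=> t; apply: (@continuous_comp _ _ _ delta (show a)); first exact: cts_fun.
  exact: show_continuous.
have f0 : f zero = e by rewrite /f path_zero ea.
have f1 : f one = act 1 e by rewrite /f path_one show_swap ea act_show.
split=> [[l lE]|->]; last first.
  by exists (mk_path cf f0 f1) => t; rewrite gammaE.
rewrite -(path_one (s := l)) -f1; apply: (@unique_lift _ _ l f zero) => //.
- exact: unit_itv_connected.
- exact: cts_fun.
- by move=> t /=; rewrite lE gammaE.
- by rewrite f0 path_zero.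
Qed.

Theorem lemma7p2 (R : realType) (X : topologicalType)
    (CX : cell_complex R X) (c : uconf X)
    (gamma : {path unit_itv R from c to c}) (hgamma : exchange_loop gamma) :
  monodromy_is gamma 1 /\
  (forall e e' : dual_aperture X, base e = c -> base e' = c ->
     (transports gamma e e' <-> e' <> e)).
Proof.
have tr e e' : base e = c -> transports gamma e e' <-> e' = act 1 e.
  by apply: transports_act1 => //; exact: cc_hausdorff CX.
split=> [e e' ec _|e e' ec e'c]; first exact: tr.
(* In a two-element fiber on which [act 1] has no fixed point, [act 1 e] is the only element other
   than [e]. *)
rewrite tr//; split => [->|ne]; first exact: act1_neq.
by case: (same_base _ _ _ (etrans ec (esym e'c))).
Qed.
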